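(* Let $a,b,c,d,f,g,h,\ell,p,r,s,t,u,w\in\mathbb R$ and let $m_n$ be the coefficient of $z^n$ in $\mathcal C(z)$ ($n\ge0$; so $m_0=1$). Then for every $n$, $$\det(m_{i+j})_{0\le i,j\le n}=(pr)^{\binom{n+1}{2}}\prod_{i=1}^n [i]_{c,d}!\,[i]_{h,\ell}!,$$ where $[i]_{x,y}!:=[i]_{x,y}[i-1]_{x,y}\cdots[1]_{x,y}$.
   Context: For $n\ge1$, $[n]_{x,y}:=\sum_{i=0}^{n-1}x^{n-1-i}y^{i}$, and $[0]_{x,y}:=0$, with the convention $0^0=1$. For real parameters $a,b,c,d,f,g,h,\ell,p,r,s,t,u,w$, $\mathcal C(z)$ is the formal power series in $z$ defined by the continued fraction $$\mathcal C(z)=\cfrac{1}{1-\alpha_0z-\cfrac{\beta_1z^2}{1-\alpha_1z-\cfrac{\beta_2z^2}{\ddots}}},\qquad \alpha_n=u\,w^n+s\,[n]_{a,b}+t\,[n]_{f,g}\ (n\ge 0),\quad \beta_n=p\,r\,[n]_{c,d}\,[n]_{h,\ell}\ (n\ge 1).$$ *)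

(* Defs.v *)
From HB Require Import structures.
From mathcomp Require Import all_boot all_order all_algebra.
From mathcomp Require Import reals.

Set Implicit Arguments.
Unset Strict Implicit.
Unset Printing Implicit Defensive.

Import Order.TTheory GRing.Theory Num.Theory.

Local Open Scope ring_scope.

(* A formal power series in z is its sequence of coefficients:
   [F n] is the coefficient of z ^ n in F. *)
Definition fps (R : Type) := nat -> R.

Section FormalPowerSeries.
Variable R : comUnitRingType.
Implicit Types F G : fps R.

Definition fps1 : fps R := fun n => (n == 0%N)%:R.

Definition fps_mul F G : fps R := fun n => \sum_(i < n.+1) F i * G (n - i)%N.

(* Multiplication by z. *)
Definition fps_mulX F : fps R := fun n => if n is n'.+1 then F n' else 0.

(* The first [n.+1] coefficients of 1 / F, obtained by solving F * G = 1
   degree by degree; see [fps_mulV]. *)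
Fixpoint fps_inv_seq F (n : nat) : seq R :=
  if n is n'.+1 then
    let s := fps_inv_seq F n' in
    rcons s (- (F 0%N)^-1 * \sum_(i < n) F i.+1 * s`_(n' - i))
  else [:: (F 0%N)^-1].

Definition fps_inv F : fps R := fun n => (fps_inv_seq F n)`_n.

Lemma size_fps_inv_seq F n : size (fps_inv_seq F n) = n.+1.
Proof. by elim: n => //= n IH; rewrite size_rcons IH. Qed.

Lemma nth_fps_inv_seq F n k : (k <= n)%N -> (fps_inv_seq F n)`_k = fps_inv F k.
Proof.
elim: n => [|n IH]; first by rewrite leqn0 => /eqP ->.
rewrite leq_eqVlt => /orP[/eqP -> //|lekn].
by rewrite /= nth_rcons size_fps_inv_seq lekn IH.
Qed.

Lemma fps_inv0 F : fps_inv F 0 = (F 0%N)^-1.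
Proof. by []. Qed.

Lemma fps_invS F n :
  fps_inv F n.+1 =
  - (F 0%N)^-1 * \sum_(i < n.+1) F i.+1 * fps_inv F (n - i)%N.
Proof.
rewrite {1}/fps_inv /= nth_rcons size_fps_inv_seq ltnn eqxx.
by congr (_ * _); apply: eq_bigr => i _; rewrite nth_fps_inv_seq // leq_subr.
Qed.

Lemma fps_mulV F : F 0%N \is a GRing.unit -> fps_mul F (fps_inv F) =1 fps1.
Proof.
move=> F0u [|n]; rewrite /fps_mul /fps1 big_ord_recl ?big_ord0 /=.
  by rewrite fps_inv0 addr0 divrr.
by rewrite subn0 fps_invS mulrA mulrN divrr // mulN1r addNr.
Qed.

Lemma eq_fps_inv F G n : (forall k, (k <= n)%N -> F k = G k) ->
  fps_inv F n = fps_inv G n.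
Proof.
elim/ltn_ind: n => -[|n] IH FG; first by rewrite !fps_inv0 FG.
rewrite !fps_invS FG //; congr (_ * _); apply: eq_bigr => i _.
rewrite FG; last by rewrite ltnS -ltnS.
by rewrite IH ?ltnS ?leq_subr // => k kn; rewrite FG // (leq_trans kn) //
  (leq_trans (leq_subr _ _)).
Qed.

End FormalPowerSeries.

Section ContinuedFraction.
Variable R : comUnitRingType.
Implicit Types (alpha beta : nat -> R) (T C : fps R).

(* 1 - alpha_k z - beta_(k+1) z^2 T(z) *)
Definition jfrac_den alpha beta (k : nat) T : fps R := fun n =>
  fps1 R n - alpha k * fps_mulX (fps1 R) n
           - beta k.+1 * fps_mulX (fps_mulX T) n.

(* The continued fraction started at level k and cut off after N levels:
     1 / (1 - alpha_k z - beta_(k+1) z^2 /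
            (... - beta_(k+N-1) z^2 / (1 - alpha_(k+N-1) z))). *)
Fixpoint jfrac_convergent alpha beta (N k : nat) : fps R :=
  if N is N'.+1 then
    fps_inv (jfrac_den alpha beta k (jfrac_convergent alpha beta N' k.+1))
  else fun=> 0.

(* C is the value of the infinite continued fraction: the limit of its
   convergents for the z-adic topology, i.e. every coefficient of the
   convergents is eventually equal to the corresponding coefficient of C.
   Existence and uniqueness are [is_jfrac_exists] and [is_jfrac_unique]. *)
Definition is_jfrac alpha beta C :=
  forall n, exists N0, forall N, (N0 <= N)%N ->
    jfrac_convergent alpha beta N 0 n = C n.

Lemma jfrac_den0 alpha beta k T : jfrac_den alpha beta k T 0 = 1.
Proof. by rewrite /jfrac_den /= !mulr0 !subr0. Qed.

Lemma jfrac_convergentP alpha beta N k :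
  fps_mul (jfrac_den alpha beta k (jfrac_convergent alpha beta N k.+1))
          (jfrac_convergent alpha beta N.+1 k) =1 fps1 R.
Proof. by apply: fps_mulV; rewrite jfrac_den0 unitr1. Qed.

Lemma jfrac_convergent_stable alpha beta N M k n : (n < N)%N -> (N <= M)%N ->
  jfrac_convergent alpha beta M k n = jfrac_convergent alpha beta N k n.
Proof.
elim: N M k n => // N IH [//|M] k n ltnN leNM /=.
apply: eq_fps_inv => -[|[|j]] //= lejn; rewrite /jfrac_den /= IH //.
by rewrite -ltnS (leq_trans _ ltnN) // ltnS ltnW.
Qed.

Lemma is_jfrac_exists alpha beta : exists C, is_jfrac alpha beta C.
Proof.
exists (fun n => jfrac_convergent alpha beta n.+1 0 n) => n.
by exists n.+1 => N leN; apply: jfrac_convergent_stable.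
Qed.

Lemma is_jfrac_unique alpha beta C C' :
  is_jfrac alpha beta C -> is_jfrac alpha beta C' -> C =1 C'.
Proof.
move=> hC hC' n; have [N hN] := hC n; have [N' hN'] := hC' n.
by rewrite -(hN (maxn N N')) ?leq_maxl // hN' // leq_maxr.
Qed.

Lemma is_jfrac_coef0 alpha beta C : is_jfrac alpha beta C -> C 0%N = 1.
Proof.
move=> /(_ 0%N)[N hN]; rewrite -(hN N.+1) //=.
by rewrite fps_inv0 jfrac_den0 invr1.
Qed.

End ContinuedFraction.

Section TwoParameterIntegers.
Variable R : comUnitRingType.
Implicit Types x y : R.

(* [n]_(x,y); note that x ^+ 0 = 1 also for x = 0. *)
Definition xyint x y (n : nat) : R := \sum_(i < n) x ^+ (n - 1 - i) * y ^+ i.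

Definition xyfact x y (n : nat) : R := \prod_(1 <= k < n.+1) xyint x y k.

Definition cf_alpha (a b f g s t u w : R) (n : nat) : R :=
  u * w ^+ n + s * xyint a b n + t * xyint f g n.

Definition cf_beta (c d h l p r : R) (n : nat) : R :=
  p * r * xyint c d n * xyint h l n.

End TwoParameterIntegers.

(* Main.v *)
(* Write C_k for the tail of the continued fraction started at level k, and
   put G_k = C_0 * (z C_1) * ... * (z C_k).  The relation
   C_k = 1 + alpha_k z C_k + beta_(k+1) z^2 C_(k+1) C_k says that the
   coefficients L n k = [z^n] G_k satisfy the tridiagonal recurrence
     L (n+1) k = L n (k-1) + alpha_k L n k + beta_(k+1) L n (k+1),
   so that L is unitriangular with first column C.  The tridiagonal matrix is
   self-adjoint for the weights B_k = beta_1 ... beta_k, hence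
   \sum_k B_k L(i,k) L(j,k) depends on i + j only and equals C (i + j): the
   Hankel matrix is L * diag(B) * L^T. *)
Require Import Defs.
From HB Require Import structures.
From mathcomp Require Import all_boot all_order all_algebra.
From mathcomp Require Import reals.
From mathcomp Require Import ring.

Set Implicit Arguments.
Unset Strict Implicit.
Unset Printing Implicit Defensive.

Import Order.TTheory GRing.Theory Num.Theory.

Local Open Scope ring_scope.

(** * Ring laws for the product of power series *)

Section FpsProduct.
Variable R : comUnitRingType.
Implicit Types F G H : fps R.

Lemma eq_fps_mul F F' G G' n :
  (forall k, (k <= n)%N -> F k = F' k) -> (forall k, (k <= n)%N -> G k = G' k) ->
  fps_mul F G n = fps_mul F' G' n.
Proof.
move=> FF' GG'; apply: eq_bigr => i _.
by rewrite FF' ?GG' ?leq_subr // -ltnS.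
Qed.

(** Truncating both factors below degree [N] does not affect this coefficient, so commutativity and
    associativity can be borrowed from [{poly R}]. *)
Lemma fps_mulE N F G n : (n < N)%N ->
  fps_mul F G n = ((\poly_(i < N) F i) * (\poly_(i < N) G i))`_n.
Proof.
move=> ltnN; rewrite coefM; apply: eq_bigr => i _.
rewrite !coef_poly (leq_ltn_trans (leq_subr _ _) ltnN).
by rewrite (leq_ltn_trans _ ltnN) // -ltnS.
Qed.

Lemma fps_mulC F G : fps_mul F G =1 fps_mul G F.
Proof. by move=> n; rewrite !(@fps_mulE n.+1) // mulrC. Qed.

Lemma fps_mulA F G H : fps_mul F (fps_mul G H) =1 fps_mul (fps_mul F G) H.
Proof.
move=> n; pose T F := \poly_(i < n.+1) F i : {poly R}.
transitivity ((T F * (T G * T H))`_n).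
  rewrite coefM; apply: eq_bigr => i _.
  by rewrite coef_poly ltn_ord (@fps_mulE n.+1) // ltnS leq_subr.
rewrite mulrA coefM; apply: eq_bigr => i _.
by rewrite -fps_mulE // coef_poly ltnS leq_subr.
Qed.

Lemma fps_mulXl F G : fps_mul (fps_mulX F) G =1 fps_mulX (fps_mul F G).
Proof.
by move=> [|n]; rewrite /fps_mul big_ord_recl /= mul0r add0r ?big_ord0.
Qed.

Lemma fps_mul_recl F G n :
  fps_mul F G n.+1 = F 0%N * G n.+1 + fps_mul (fun i => F i.+1) G n.
Proof. by rewrite /fps_mul big_ord_recl. Qed.

Lemma fps_mulDl (x y : R) F F' G n :
  fps_mul (fun i => x * F i + y * F' i) G n =
  x * fps_mul F G n + y * fps_mul F' G n.
Proof.
rewrite /fps_mul !mulr_sumr -big_split /=.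
by apply: eq_bigr => i _; rewrite mulrDl !mulrA.
Qed.

End FpsProduct.

(** * Tails of the continued fraction and the series G_k *)

Section Tails.
Variables (R : comUnitRingType) (alpha beta : nat -> R).

(** This is C_k: coefficient [n] no longer changes once [n.+1] levels are kept. *)
Definition jfrac_tail k : fps R := fun n => jfrac_convergent alpha beta n.+1 k n.

Lemma jfrac_tailE N k n : (n < N)%N ->
  jfrac_convergent alpha beta N k n = jfrac_tail k n.
Proof. by move=> ltnN; apply: jfrac_convergent_stable. Qed.

Lemma is_jfrac_tail C : is_jfrac alpha beta C -> C =1 jfrac_tail 0.
Proof.
move=> hC n; have [N hN] := hC n.
by rewrite -(hN (maxn N n.+1)) ?leq_maxl // jfrac_tailE // leq_maxr.
Qed.

Lemma jfrac_tail0 k : jfrac_tail k 0 = 1.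
Proof. by rewrite /jfrac_tail /= fps_inv0 jfrac_den0 invr1. Qed.

Lemma jfrac_tailP k :
  fps_mul (jfrac_den alpha beta k (jfrac_tail k.+1)) (jfrac_tail k) =1 fps1 R.
Proof.
(* Degree [n] of the product involves only coefficients up to [n], where convergents with more than
   [n] levels agree with the tails. *)
move=> n; rewrite -(@jfrac_convergentP _ alpha beta n.+1 k n).
apply: eq_fps_mul => j lejn; last by rewrite jfrac_tailE // ltnS leqW.
rewrite /jfrac_den; case: j lejn => [|[|j]] lejn //.
congr (_ - _ * _); apply/esym/jfrac_tailE.
by rewrite ltnS (leq_trans _ lejn) // leqW.
Qed.

Lemma jfrac_tailS k n :
  jfrac_tail k n.+1 =
  alpha k * jfrac_tail k n +
  beta k.+1 * fps_mulX (fps_mul (jfrac_tail k.+1) (jfrac_tail k)) n.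
Proof.
have := jfrac_tailP k n.+1; rewrite fps_mul_recl jfrac_den0 mul1r /fps1 /=.
set D := (X in fps_mul X _ n).
have -> : fps_mul D (jfrac_tail k) n =
  fps_mul (fun i => - alpha k * fps1 R i
                    + - beta k.+1 * fps_mulX (jfrac_tail k.+1) i)
          (jfrac_tail k) n.
  apply: eq_fps_mul => // i _.
  by rewrite /D /jfrac_den /fps1 /= sub0r !mulNr.
rewrite fps_mulDl fps_mulXl.
have -> : fps_mul (fps1 R) (jfrac_tail k) n = jfrac_tail k n.
  rewrite /fps_mul big_ord_recl /fps1 /= mul1r subn0 big1 ?addr0 // => i _.
  by rewrite mul0r.
by rewrite !mulNr -opprD => /eqP; rewrite subr_eq0 => /eqP.
Qed.

(** This is G_k; its coefficient of z^n is the entry L n k. *)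
Fixpoint jfrac_column k : fps R :=
  if k is k'.+1 then fps_mulX (fps_mul (jfrac_tail k) (jfrac_column k'))
  else jfrac_tail 0.

Lemma jfrac_column0 k : jfrac_column k 0 = (k == 0%N)%:R.
Proof. by case: k => //=; rewrite jfrac_tail0. Qed.

Lemma jfrac_columnS0 n :
  jfrac_column 0 n.+1 = alpha 0 * jfrac_column 0 n + beta 1 * jfrac_column 1 n.
Proof. exact: jfrac_tailS. Qed.

(** In G_(k+1) = z C_(k+1) G_k, expand C_(k+1) by its tail relation: the three terms give z G_k,
    alpha_(k+1) z G_(k+1) and beta_(k+2) z G_(k+2). *)
Lemma jfrac_columnSS k n :
  jfrac_column k.+1 n.+1 =
  jfrac_column k n + alpha k.+1 * jfrac_column k.+1 n
  + beta k.+2 * jfrac_column k.+2 n.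
Proof.
rewrite [LHS]/=; case: n => [|n].
  by rewrite /fps_mul big_ord_recl big_ord0 /= jfrac_tail0 mul1r !mulr0 !addr0.
rewrite fps_mul_recl jfrac_tail0 mul1r -addrA; congr (_ + _).
rewrite (eq_fps_mul (fun i _ => jfrac_tailS k.+1 i) (fun _ _ => erefl)).
rewrite fps_mulDl fps_mulXl [jfrac_column k.+2]/=; congr (_ + _ * _).
rewrite [RHS]fps_mulC fps_mulXl.
by case: n => //= n; rewrite [RHS]fps_mulC fps_mulA.
Qed.

End Tails.

(** * Gram sums of a tableau obeying the tridiagonal recurrence *)

Section Tableau.
Variables (R : comUnitRingType) (alpha beta : nat -> R) (L : nat -> nat -> R).
Hypothesis L0 : forall k, L 0%N k = (k == 0%N)%:R.
Hypothesis LS0 : forall n,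
  L n.+1 0%N = alpha 0%N * L n 0%N + beta 1%N * L n 1%N.
Hypothesis LSS : forall n k,
  L n.+1 k.+1 = L n k + alpha k.+1 * L n k.+1 + beta k.+2 * L n k.+2.

Definition weight k : R := \prod_(1 <= j < k.+1) beta j.

Lemma weight0 : weight 0 = 1. Proof. by rewrite /weight big_geq. Qed.

Lemma weightS k : weight k.+1 = weight k * beta k.+1.
Proof. by rewrite /weight big_nat_recr. Qed.

Lemma tableau_eq0 n k : (n < k)%N -> L n k = 0.
Proof.
elim: n k => [|n IH] [//|k] ltnk; first by rewrite L0.
by rewrite LSS !IH ?mulr0 ?addr0 // ltnW // ltnW.
Qed.

Lemma tableau_diag n : L n n = 1.
Proof.
by elim: n => [|n IH]; rewrite ?L0 // LSS IH !tableau_eq0 // !mulr0 !addr0.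
Qed.

(** The cutoff [N] is kept free: the sum is the same for every [N] above [i], and shifting indices
    needs room beyond the matrix size. *)
Definition gram N i j := \sum_(k < N) weight k * L i k * L j k.

Lemma gramC N i j : gram N i j = gram N j i.
Proof. by apply: eq_bigr => k _; rewrite mulrAC. Qed.

Lemma gram_stable N M i j : (i < N)%N -> (N <= M)%N -> gram M i j = gram N i j.
Proof.
move=> ltiN /subnKC <-; elim: (M - N)%N => [|m IH]; first by rewrite addn0.
rewrite addnS /gram big_ord_recr /= -/(gram _ i j) IH.
by rewrite tableau_eq0 ?mulr0 ?mul0r ?addr0 // ltn_addr.
Qed.

Let offdiag N i j := \sum_(k < N) weight k.+1 * L i k.+1 * L j k.

(** Since B_k beta_(k+1) = B_(k+1), both neighbour terms of the recurrence become [offdiag] sums,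
    which exchanging [i] and [j] merely swaps. *)
Lemma gramSl N i j : (j <= N)%N ->
  gram N.+1 i.+1 j =
  offdiag N.+1 j i + \sum_(k < N.+1) alpha k * weight k * L i k * L j k
  + offdiag N.+1 i j.
Proof.
move=> lejN; rewrite /gram /offdiag [X in _ = X + _ + _]big_ord_recr /=.
(* The boundary term contains [L j N.+1], which vanishes because [j <= N]. *)
rewrite (@tableau_eq0 j N.+1) // mulr0 mul0r addr0.
rewrite big_ord_recl [X in _ = _ + X + _]big_ord_recl [X in _ = _ + X]big_ord_recl /=.
rewrite LS0 !weightS weight0.
under eq_bigr do rewrite LSS.
transitivity ((alpha 0%N * L i 0%N + beta 1%N * L i 1%N) * L j 0%N +
  \sum_(k < N) (weight k.+1 * L j k.+1 * L i k +
     alpha k.+1 * weight k.+1 * L i k.+1 * L j k.+1 +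
     weight k.+2 * L i k.+2 * L j k.+1)).
  rewrite mul1r; congr (_ + _); apply: eq_bigr => k _.
  by rewrite /bump /= add1n !weightS; ring.
rewrite !big_split /=; ring.
Qed.

Lemma gram_shift N i j : (i <= N)%N -> (j <= N)%N ->
  gram N.+1 i.+1 j = gram N.+1 i j.+1.
Proof.
move=> leiN lejN; rewrite [RHS]gramC !gramSl //.
rewrite [LHS]addrC [X in _ + X = _]addrC addrA; congr (_ + _ + _).
by apply: eq_bigr => k _; rewrite mulrAC.
Qed.

(** Units move from [j] to [i] until [j] is 0, where row 0 of [L] selects the term [k = 0]. *)
Lemma gram_hankel N i j : (i + j <= N)%N -> gram N.+1 i j = L (i + j)%N 0%N.
Proof.
elim: j i => [|j IH] i leN.
  rewrite addn0 /gram big_ord_recl L0 weight0 mul1r mulr1 big1 ?addr0 // => k _.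
  by rewrite L0 mulr0.
rewrite -gram_shift ?IH ?addSnnS //.
  exact: leq_trans (leq_addr _ _) leN.
by apply: leq_trans leN; rewrite addnS ltnW // ltnS leq_addl.
Qed.

Lemma det_hankel_tableau n :
  \det (\matrix_(i < n.+1, j < n.+1) L (i + j)%N 0%N) = \prod_(k < n.+1) weight k.
Proof.
pose T := \matrix_(i < n.+1, j < n.+1) L i j.
pose D := \row_(k < n.+1) weight k.
have -> : \matrix_(i < n.+1, j < n.+1) L (i + j)%N 0%N = T *m diag_mx D *m T^T.
  (* The cutoff must be at least [i + j] for the Hankel identity and at least [n], so that
     [gram_stable] can bring it down to [n.+1]. *)
  apply/matrixP => i j; rewrite !mxE -(@gram_hankel (n + i + j)); last first.
    by rewrite -addnA leq_addl.
  rewrite (@gram_stable n.+1) //; last by rewrite ltnS -addnA leq_addr.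
  by apply: eq_bigr => k _; rewrite mul_mx_diag !mxE [L i k * _]mulrC.
have detT : \det T = 1.
  rewrite det_trig; last first.
    by apply/is_trig_mxP => i j ltij; rewrite mxE tableau_eq0.
  by rewrite big1 // => i _; rewrite mxE tableau_diag.
rewrite !det_mulmx det_tr detT mul1r mulr1 det_diag.
by apply: eq_bigr => k _; rewrite mxE.
Qed.

End Tableau.

Lemma det_hankel_jfrac (R : comUnitRingType) (alpha beta : nat -> R) (C : fps R) n :
  is_jfrac alpha beta C ->
  \det (\matrix_(i < n.+1, j < n.+1) C (i + j)%N) =
  \prod_(k < n.+1) \prod_(1 <= j < k.+1) beta j.
Proof.
move=> /is_jfrac_tail hC.
rewrite -(@det_hankel_tableau _ alpha beta (fun i k => jfrac_column alpha beta k i)).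
- by congr (\det _); apply/matrixP => i j; rewrite !mxE hC.
- exact: jfrac_column0.
- exact: jfrac_columnS0.
- by move=> m k; apply: jfrac_columnSS.
Qed.

Lemma prod_cf_beta (R : comUnitRingType) (c d h l p r : R) k :
  \prod_(1 <= j < k.+1) cf_beta c d h l p r j =
  (p * r) ^+ k * (xyfact c d k * xyfact h l k).
Proof.
elim: k => [|k IH]; first by rewrite /xyfact !big_geq // !mulr1.
rewrite big_nat_recr //= IH /xyfact !(big_nat_recr k.+1) //= exprS /cf_beta.
ring.
Qed.

Theorem corollary2 (R : realType) (a b c d f g h l p r s t u w : R)
    (C : fps R)
    (hC : is_jfrac (cf_alpha a b f g s t u w) (cf_beta c d h l p r) C)
    (n : nat) :
  \det (\matrix_(i < n.+1, j < n.+1) C (i + j)%N) =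
  (p * r) ^+ 'C(n.+1, 2) *
  \prod_(1 <= i < n.+1) (xyfact c d i * xyfact h l i).
Proof.
rewrite (det_hankel_jfrac n hC).
rewrite (eq_bigr _ (fun (k : 'I_n.+1) _ => prod_cf_beta c d h l p r k)).
rewrite big_split /= -expr_sum; congr (_ ^+ _ * _).
  (* The exponents add up to 0 + 1 + ... + n. *)
  by rewrite -bin2_sum big_mkord.
(* The extra factor at index 0 is a product of empty factorials, hence 1. *)
rewrite -(big_mkord xpredT (fun i => xyfact c d i * xyfact h l i)) big_ltn //.
by rewrite [xyfact c d 0]big_geq ?[xyfact h l 0]big_geq ?mul1r.
Qed.
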